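(* Let $d\in\mathbb N$, $\gamma>0$, let $\Lambda\subset\mathbb R^d$ be compact with homogeneously ordered box dimension at most $\gamma$, and let $\{T_{n,\lambda}: n\in\mathbb N,\lambda\in\Lambda\}$ be a continuous family of operators acting on an $F$-space $X$. Assume that there are a dense set $\mathcal D\subset X$, maps $S_{n,\lambda}:\mathcal D\to\mathcal D$ ($n\in\mathbb N$, $\lambda\in\Lambda$) such that $T_{n,\lambda}\circ S_{n,\lambda}=\mathrm{Id}$ on $\mathcal D$, and $D>0$ such that, for all $u\in\mathcal D$, the following two properties hold. (CS1) There exist $\kappa\in\mathbb N$ and a summable sequence of positive numbers $(c_k)_k$ such that, for all integers $n\ge0$ and $k\ge\kappa$ and all $\lambda,\mu\in\Lambda$ satisfying $\|\lambda-\mu\|\le D\frac{k^{1/\gamma}}{(n+k)^{1/\gamma}}$, we have $$\|T_{n+k,\lambda}\circ S_{n,\mu}u\|\le c_k\quad\text{and}\quad\|T_{n,\lambda}\circ S_{n+k,\mu}u\|\le c_k.$$ (CS2) For every $\eta>0$ there is $\tau>0$ such that, for all $n\in\mathbb N$ and all $\lambda,\mu\in\Lambda$, $$\|\lambda-\mu\|\le\frac{\tau}{n^{1/\gamma}}\implies\|T_{n,\lambda}\circ S_{n,\mu}u-u\|\le\eta.$$ Then the set of common universal vectors for the family $\{T_{n,\lambda}: n\in\mathbb N,\lambda\in\Lambda\}$ is a dense $G_\delta$ subset of $X$.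
   Context: $\mathbb N=\{1,2,\dots\}$. $\mathbb R^d$ carries the maximum norm $\|\lambda-\mu\|=\max_j|\lambda(j)-\mu(j)|$, and $\mathrm{diam}$ is taken with respect to it. For $r,m\in\mathbb N$, $I_r=\{1,\dots,r\}$ and multi-indices $\mathbf i\in I_r^m$ are written $\mathbf i=(i_1,\dots,i_m)$. Definition. A compact set $\Lambda\subset\mathbb R^d$ has homogeneously ordered box dimension (HBD$^\circ$) at most $\gamma\in(0,d]$ if there exist an integer $r\ge2$, a real $\rho>0$ and, for all $m\ge1$, a covering $(\Lambda_{\mathbf i})_{\mathbf i\in I_r^m}$ of $\Lambda$ by compact sets such that: (i) for all $m\ge 1$ and $\mathbf i\in I_r^m$, $\mathrm{diam}(\Lambda_{\mathbf i})\le\rho\,(1/r^{1/\gamma})^m$; (ii) for all $m\ge 1$ and $(i_1,\dots,i_{m+1})\in I_r^{m+1}$, $\Lambda_{i_1,\dots,i_{m+1}}\subset\Lambda_{i_1,\dots,i_m}$; (iii) for all $m\ge 1$, $\mathbf i=(i_1,\dots,i_m)\in I_r^m$ and $j\in\{2,\dots,r\}$, $\Lambda_{\mathbf i,j-1,r}\cap\Lambda_{\mathbf i,j,1}\ne\varnothing$. An $F$-space is a topological vector space whose topology is induced by a complete translation-invariant metric $\delta$; for $x\in X$, $\|x\|:=\delta(x,0)$. An operator is a continuous linear map $X\to X$. The family $\{T_{n,\lambda}\}$ is continuous if, for each $n\in\mathbb N$, the map $(\lambda,u)\mapsto T_{n,\lambda}u$ from $\Lambda\times X$ to $X$ is continuous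 for the product topology. By convention $T_{0,\lambda}=\mathrm{Id}$ on $X$ and $S_{0,\lambda}=\mathrm{Id}$ on $\mathcal D$ for all $\lambda$. A vector $u\in X$ is a common universal vector for $\{T_{n,\lambda}: n\in\mathbb N,\lambda\in\Lambda\}$ if, for every $\lambda\in\Lambda$, the set $\{T_{n,\lambda}u:n\in\mathbb N\}$ is dense in $X$.
   Formalization: The F-space X is additionally assumed separable; without this the claim fails (multiples of the backward shift on ℓ²(ℕ,H), H nonseparable, Λ a singleton), and for nonempty Λ the conclusion forces separability. *)

(* Defs.v *)
From mathcomp Require Import all_boot all_order all_algebra.
From mathcomp Require Import all_classical all_reals all_analysis.
From mathcomp Require Import borel_hierarchy.
Set Implicit Arguments.
Unset Strict Implicit.
Unset Printing Implicit Defensive.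
Import Order.TTheory GRing.Theory Num.Theory.
Import numFieldNormedType.Exports.
Local Open Scope classical_set_scope.
Local Open Scope ring_scope.

(* The scalar field K is an arbitrary numFieldType, so that real (K := R) and
   complex (K := R[i]) F-spaces are both covered; the metric takes values in R.
   The structure tvsType is not used because it requires local convexity. *)
Record fspaceType (R : realType) (K : numFieldType) := FSpace {
  fspace_sort :> topologicalLmodType K ;
  fdist : fspace_sort -> fspace_sort -> R ;
  fdist_eq0 : forall x y, fdist x y = 0 <-> x = y ;
  fdist_sym : forall x y, fdist x y = fdist y x ;
  fdist_triangle : forall y x z, fdist x z <= fdist x y + fdist y z ;
  fdist_translation : forall x y z, fdist (x + z) (y + z) = fdist x y ;
  fdist_nbhs : forall (x : fspace_sort) (A : set fspace_sort),
    nbhs x A <-> exists2 e : R, 0 < e & [set y | fdist x y < e] `<=` A ;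
  fdist_complete : forall v : nat -> fspace_sort,
    (forall e : R, 0 < e -> exists N : nat, forall m n : nat,
       (N <= m)%N -> (N <= n)%N -> fdist (v m) (v n) < e) ->
    exists x : fspace_sort, v @ \oo --> x
}.

Definition fnorm (R : realType) (K : numFieldType) (X : fspaceType R K)
  (x : X) : R := fdist x 0.

(* A single universal vector has a countable dense orbit, so separability is
   forced as soon as the parameter set is nonempty. *)
Definition separable (X : topologicalType) :=
  exists Q : set X, countable Q /\ dense Q.

Definition operator (R : realType) (K : numFieldType) (X : fspaceType R K)
  (f : X -> X) := linear f /\ continuous f.

(* The norm of 'rV[R]_d is the maximum norm. *)
Definition diam (R : realType) (d : nat) (A : set 'rV[R]_d) : \bar R :=
  ereal_sup [set `|x - y|%:E | x in A & y in A].

(* The coverings of all levels are gathered in one family L indexed by nonempty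
   words over 'I_r (L [::] is irrelevant); the letters 1, ..., r are encoded as
   0, ..., r - 1, and a word is extended on the right.  As the word "covering"
   allows, the sets L i need not be included in Lam. *)
Definition HBDo_le (R : realType) (d : nat) (Lam : set 'rV[R]_d) (gam : R) :=
  compact Lam /\ 0 < gam <= d%:R /\
  exists (r : nat) (rho : R) (L : seq 'I_r -> set 'rV[R]_d),
    [/\ (2 <= r)%N, 0 < rho,
        forall m, (0 < m)%N ->
          Lam `<=` \bigcup_(i in [set i : seq 'I_r | size i = m]) L i &
        forall i, (0 < size i)%N -> compact (L i)] /\
    [/\ forall m (i : seq 'I_r), (0 < m)%N -> size i = m ->
          (diam (L i) <= (rho * (1 / r%:R `^ (1 / gam)) ^+ m)%:E)%E,
        forall (i : seq 'I_r) (j : 'I_r), (0 < size i)%N ->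
          L (rcons i j) `<=` L i &
        forall (i : seq 'I_r) (j j' first last : 'I_r), (0 < size i)%N ->
          j = j'.+1 :> nat -> first = 0%N :> nat -> last = r.-1 :> nat ->
          L (rcons (rcons i j') last) `&` L (rcons (rcons i j) first) !=set0].

Section Criterion.
Context (R : realType) (K : numFieldType) (X : fspaceType R K) (d : nat).
Implicit Types (Lam : set 'rV[R]_d) (T S : nat -> 'rV[R]_d -> X -> X).

(* Families indexed by Lam are total functions of the parameter, constrained
   only on Lam; the value at n = 0 is the conventional identity. *)
Definition operator_family Lam T :=
  (forall l, Lam l -> forall u, T 0%N l u = u) /\
  (forall n l, (0 < n)%N -> Lam l -> operator (T n l)).

Definition continuous_family Lam T :=
  forall n, (0 < n)%N ->
    {within Lam `*` [set: X],
      continuous (fun p : 'rV[R]_d * X => T n p.1 p.2)}.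

Definition right_inverse_family Lam (DD : set X) T S :=
  (forall l, Lam l -> forall u, DD u -> S 0%N l u = u) /\
  (forall n l u, (0 < n)%N -> Lam l -> DD u ->
     DD (S n l u) /\ T n l (S n l u) = u).

Definition CS1 Lam (gam D : R) T S (u : X) :=
  exists (kappa : nat) (c : nat -> R),
    [/\ (0 < kappa)%N, forall k, 0 < c k, cvgn (series c) &
      forall (n k : nat) (l mu : 'rV[R]_d), (kappa <= k)%N ->
        Lam l -> Lam mu ->
        `|l - mu| <= D * (k%:R `^ (1 / gam) / (n + k)%:R `^ (1 / gam)) ->
        fnorm (T (n + k)%N l (S n mu u)) <= c k /\
        fnorm (T n l (S (n + k)%N mu u)) <= c k].

Definition CS2 Lam (gam : R) T S (u : X) :=
  forall eta : R, 0 < eta -> exists2 tau : R, 0 < tau &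
    forall (n : nat) (l mu : 'rV[R]_d), (0 < n)%N -> Lam l -> Lam mu ->
      `|l - mu| <= tau / n%:R `^ (1 / gam) ->
      fnorm (T n l (S n mu u) - u) <= eta.

Definition common_universal Lam T : set X :=
  [set u | forall l, Lam l -> dense [set T n l u | n in [set n | (0 < n)%N]]].

End Criterion.

(* Main.v *)
(* By Baire's theorem it suffices that, for v in DD and a word w of fixed length,
   the vectors whose orbit under every parameter l of a piece of Lam lying below
   w at all levels comes close to v are dense.  Near v0 in DD one takes
   u = v0 + sum_m S_{m, p(m)} v over finitely many times m >= N pairwise N apart,
   where the points p(m) are chosen in sets A_m covering the piece.  With
   psi(x, y) = |x - y|^gam, CS2 handles the diagonal term if psi <= tau / m on
   A_m, and CS1 sums the other terms if psi <= D^gam (m' - m) / m' between A_m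
   and A_m' for m < m'.

   The A_m are found by a depth-first search of the tree of words, where psi is
   at most rho^gam r^(-b) on a piece of level b.  A piece entered at time n is
   served as soon as rho^gam r^(-b) <= tau / n; before entering a child of a
   piece of level b one waits for about 2 (rho / D)^gam r^(-b) n.  A search below
   w down to level |w| + k then multiplies the time by at most
   exp((alpha k + beta) r^(-|w|)), with alpha independent of N and tau.  For |w|
   large this grows more slowly than r^k, so at some k the pieces of level
   |w| + k are all small enough to be served, and the search ends. *)

Require Import Defs.
From mathcomp Require Import all_boot all_order all_algebra.
From mathcomp Require Import all_classical all_reals all_analysis.
From mathcomp Require Import borel_hierarchy.
From mathcomp Require Import zify ring lra.
Set Implicit Arguments.
Unset Strict Implicit.
Unset Printing Implicit Defensive.
Import Order.TTheory GRing.Theory Num.Theory.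
Import numFieldNormedType.Exports.
Local Open Scope classical_set_scope.
Local Open Scope ring_scope.

(** * Serving the pieces below a word at spaced times *)

Section Schedule.
Context (R : realType) (r : nat) (P : Type).
Variables (L : seq 'I_r -> set P) (psi : P -> P -> R).

Fixpoint level_cover k (w : seq 'I_r) : set P :=
  if k is k'.+1 then \bigcup_j level_cover k' (rcons w j) else L w.

(* A m is the piece of U served at time m, empty when m is not used; the times
   used are N apart.  For psi x y = |x - y|^gam the last two conditions are the
   hypotheses of CS2 and CS1. *)
Definition schedule (tau D : R) (N n e : nat) (U : set P) (A : nat -> set P) :=
  [/\ forall m x, A m x -> [/\ (n <= m)%N, (m + N <= e)%N & U x],
      forall m x y, A m x -> A m y -> psi x y * m%:R <= tau &
      forall m m' x y, A m x -> A m' y -> (m < m')%N ->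
        (m + N <= m')%N /\ psi x y * m'%:R <= D * (m' - m)%:R].

Hypothesis L_nested :
  forall (w : seq 'I_r) j, (0 < size w)%N -> L (rcons w j) `<=` L w.

Lemma level_cover_sub k w : (0 < size w)%N -> level_cover k w `<=` L w.
Proof.
elim: k w => [|k IH] w w0; first exact: subset_refl.
move=> x [j _ /IH]; rewrite size_rcons => /(_ isT).
exact: L_nested.
Qed.

Lemma level_coverS k w :
  (0 < size w)%N -> level_cover k.+1 w `<=` level_cover k w.
Proof.
elim: k w => [|k IH] w w0; first exact: (@level_cover_sub 1).
move=> x [j _ Hx]; exists j => //; apply: IH => //.
by rewrite size_rcons.
Qed.

(** The two time ranges are disjoint, so only pairs with one time in each are new; the last
    hypothesis settles them, and [e <= n1] gives the distance [N]. *)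
Lemma schedule_cat tau D N n e n1 e1 U A A1 : (0 < N)%N ->
  (n <= e)%N -> (e <= n1)%N -> (n1 <= e1)%N ->
  schedule tau D N n e U A -> schedule tau D N n1 e1 U A1 ->
  (forall m m' x y, (m + N <= e)%N -> (n1 <= m')%N -> U x -> U y ->
    psi x y * m'%:R <= D * (m' - m)%:R) ->
  schedule tau D N n e1 U (fun m => A m `|` A1 m).
Proof.
move=> N0 ne en1 n1e1 [a1 a2 a3] [b1 b2 b3] X; split.
- by move=> m x [/a1|/b1] [? ? ?]; split=> //; lia.
- move=> m x y [Hx|Hx] [Hy|Hy].
  + exact: a2 Hx Hy.
  + by have [_ ? _] := a1 _ _ Hx; have [? _ _] := b1 _ _ Hy; lia.
  + by have [_ ? _] := a1 _ _ Hy; have [? _ _] := b1 _ _ Hx; lia.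
  + exact: b2 Hx Hy.
- move=> m m' x y [Hx|Hx] [Hy|Hy] mm'.
  + exact: a3 Hx Hy mm'.
  + have [_ ? ?] := a1 _ _ Hx; have [? _ ?] := b1 _ _ Hy.
    by split; [lia|exact: X].
  + by have [_ ? _] := a1 _ _ Hy; have [? _ _] := b1 _ _ Hx; lia.
  + exact: b3 Hx Hy mm'.
Qed.

Lemma schedule_sub tau D N n e n' U V A : (n' <= n)%N -> U `<=` V ->
  schedule tau D N n e U A -> schedule tau D N n' e V A.
Proof.
move=> nn UV [a1 a2 a3]; split => // m x /a1[? ? ?].
by split; [lia| |exact: UV].
Qed.

(** In the application [rho] and [D] become the powers rho^gam and D^gam. *)
Variables (rho tau D : R) (N : nat).
Hypotheses (r_gt1 : (1 < r)%N) (rho_gt0 : 0 < rho) (tau_gt0 : 0 < tau)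
  (D_gt0 : 0 < D) (N_gt0 : (0 < N)%N).
Hypothesis L_small : forall (w : seq 'I_r) x y, (0 < size w)%N ->
  L w x -> L w y -> psi x y * r%:R ^+ size w <= rho.

(** [g] / r^b is the pause at level b relative to the current time. Serving a piece of level b
    blocks [N] units of time, at most n [B] / r^b once n >= tau r^b / (r rho). *)
Let g := 2 * rho / D.
Let B := N%:R * r%:R * rho / tau.

Let g_gt0 : 0 < g. Proof. by rewrite /g !mulr_gt0 ?invr_gt0. Qed.
Let B_ge0 : 0 <= B. Proof. by rewrite /B !mulr_ge0 ?invr_ge0// ltW. Qed.
Let r_gt0 : 0 < r%:R :> R. Proof. by rewrite ltr0n ltnW. Qed.

Let gk_ge0 k : 0 <= g * r%:R * k%:R.
Proof. by rewrite mulr_ge0// mulr_ge0// ltW. Qed.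
Let cost_ge0 k : 0 <= g * r%:R * k%:R + B.
Proof. exact: addr_ge0. Qed.

(** With h = [g] / r^|w| <= 1, [L_small] reads psi <= D h / 2, so it suffices that h m' / 2 <= m' -
    m. The pause has about h e units; rounding it down loses less than 1, which [m + N <= e] with N
    > 0 makes up for. *)
Lemma gap_cross (w : seq 'I_r) e m m' x y : (0 < size w)%N ->
  g <= r%:R ^+ size w -> (m + N <= e)%N ->
  (e + Num.truncn (g * e%:R / r%:R ^+ size w) <= m')%N ->
  L w x -> L w y -> psi x y * m'%:R <= D * (m' - m)%:R.
Proof.
move=> w0 ga me em' Lx Ly.
have H := L_small w0 Lx Ly; set ra := r%:R ^+ size w in ga em' H *.
have ra0 : 0 < ra by rewrite exprn_gt0.
set t := Num.truncn _ in em'.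
set h := g / ra; have h1 : h <= 1 by rewrite /h ler_pdivrMr ?mul1r.
have h0 : 0 < h by rewrite divr_gt0.
have et : g * e%:R / ra = h * e%:R by rewrite /h; ring.
have /andP[t1 t2] : t%:R <= h * e%:R < t.+1%:R.
  by rewrite -et; apply: truncn_itv; rewrite et mulr_ge0// ltW.
have psiE : psi x y <= D * h / 2.
  rewrite /h /g; have -> : D * (2 * rho / D / ra) / 2 = rho / ra.
    by field; rewrite !gt_eqF.
  by rewrite ler_pdivlMr.
have lt_me : (m < e)%N by apply: leq_trans me; rewrite -[m.+1]addn1 leq_add2l.
have mm : (m + t.+1 <= e + t)%N by rewrite addnS -addSn leq_add2r.
have mm' : (m <= m')%N.
  by apply: leq_trans em'; rewrite (leq_trans (ltnW lt_me))// leq_addr.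
have {mm} mm : m%:R + t.+1%:R <= e%:R + t%:R :> R by rewrite -!natrD ler_nat.
have {em'} em' : e%:R + t%:R <= m'%:R :> R by rewrite -natrD ler_nat.
rewrite natrB//.
have key : h / 2 * m'%:R <= m'%:R - m%:R :> R.
  have e0 : 0 <= e%:R :> R by [].
  have te : t%:R <= e%:R :> R by rewrite (le_trans t1)// ler_piMl.
  have hte : h * t%:R <= h * e%:R by rewrite ler_wpM2l// ltW.
  have hs : h * (m'%:R - (e%:R + t%:R)) <= m'%:R - (e%:R + t%:R).
    by rewrite ler_piMl// subr_ge0.
  rewrite -natr1 in mm t2; lra.
apply: (@le_trans _ _ (D * h / 2 * m'%:R)); first by rewrite ler_wpM2r.
rewrite (_ : _ * m'%:R = D * (h / 2 * m'%:R)); last by rewrite !mulrA.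
by rewrite ler_wpM2l// ltW.
Qed.

(** The whole piece is served at the single time [n], when it is small enough; the lower bound on
    [n] pays for the [N] units then blocked. *)
Lemma schedule_leaf k (w : seq 'I_r) n : (0 < size w)%N ->
  tau * r%:R ^+ size w <= r%:R * rho * n%:R ->
  rho * n%:R <= tau * r%:R ^+ size w ->
  exists A e, [/\ schedule tau D N n e (L w) A,
    level_cover k w `<=` \bigcup_m A m, (n <= e)%N &
    e%:R <= n%:R * expR ((g * r%:R * k%:R + B) / r%:R ^+ size w)].
Proof.
move=> w0 lo hi.
have ra0 : 0 < r%:R ^+ size w :> R by rewrite exprn_gt0.
exists (fun m => [set x | m = n /\ level_cover k w x]), (n + N)%N; split.
- split.
  + by move=> m x [-> /level_cover_sub-/(_ w0)].
  + move=> m x y [-> /level_cover_sub-/(_ w0) Lx] [_ /level_cover_sub-/(_ w0) Ly].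
    have := L_small w0 Lx Ly; rewrite -ler_pdivlMr// => H.
    apply: (@le_trans _ _ (rho / r%:R ^+ size w * n%:R)).
      by rewrite ler_wpM2r.
    by rewrite mulrAC ler_pdivrMr.
  + by move=> m m' x y [-> _] [-> _]; rewrite ltnn.
- by move=> x Hx; exists n.
- exact: leq_addr.
- set ra := _ ^+ _ in ra0 lo hi *.
  apply: (@le_trans _ _ (n%:R * (1 + (g * r%:R * k%:R + B) / ra))); last first.
    by rewrite ler_wpM2l// expR_ge1Dx.
  rewrite natrD mulrDr mulr1 lerD2l.
  apply: (@le_trans _ _ (n%:R * (B / ra))); last first.
    rewrite ler_wpM2l// ler_wpM2r ?invr_ge0 ?(ltW ra0)// lerDr.
    exact: gk_ge0.
  rewrite /B; have -> : n%:R * (N%:R * r%:R * rho / tau / ra) =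
    N%:R * ((r%:R * rho * n%:R) / (tau * ra)) :> R.
    by field; rewrite !gt_eqF.
  by rewrite ler_peMr// ler_pdivlMr ?mulr_gt0// mul1r.
Qed.

(* A word of length a entered at time n is served at once if its piece is small
   enough for that time; otherwise its children are served one after the other,
   with a pause of about g n / r^a before each.  In logarithmic scale, the
   pauses at one level below w cost g r / r^a altogether, and the served pieces
   cost B / r^a. *)
Lemma schedule_level_cover k (w : seq 'I_r) n : (0 < size w)%N ->
  g <= r%:R ^+ size w -> tau * r%:R ^+ size w <= r%:R * rho * n%:R ->
  rho * n%:R * expR ((g * r%:R * k%:R + B) / r%:R ^+ size w)
    <= tau * r%:R ^+ (size w + k) ->
  exists A e, [/\ schedule tau D N n e (L w) A,
    level_cover k w `<=` \bigcup_m A m, (n <= e)%N &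
    e%:R <= n%:R * expR ((g * r%:R * k%:R + B) / r%:R ^+ size w)].
Proof.
elim: k w n => [|k IH] w n w0 ga lo up.
  apply: schedule_leaf => //; rewrite addn0 in up; apply: le_trans up.
  rewrite ler_peMr ?mulr_ge0 ?(ltW rho_gt0)//.
  apply: le_trans (expR_ge1Dx _); rewrite lerDl.
  by apply: divr_ge0; [exact: cost_ge0|exact: exprn_ge0].
have [hi|hi] := leP (rho * n%:R) (tau * r%:R ^+ size w); first exact: schedule_leaf.
have ra0 : 0 < r%:R ^+ size w :> R by rewrite exprn_gt0.
set ra := _ ^+ _ in ga lo up hi ra0 *.
(* In logarithmic scale, [x1] is the cost of one child and [x2] that of the pause before it; [r]
   times their sum is exactly the budget of [w]. *)
set x1 := (g * r%:R * k%:R + B) / (r%:R * ra); set x2 := g / ra.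
have x1_ge0 : 0 <= x1.
  by apply: divr_ge0; [exact: cost_ge0|rewrite mulr_ge0// ltW].
have x2_ge0 : 0 <= x2 by rewrite divr_ge0 ?ltW.
have xE : (g * r%:R * k.+1%:R + B) / ra = r%:R * (x1 + x2).
  by rewrite /x1 /x2 -natr1; field; rewrite !gt_eqF.
rewrite xE in up *.
have children i : (i <= r)%N -> exists A e, [/\ schedule tau D N n e (L w) A,
    forall j : 'I_r, (j < i)%N -> level_cover k (rcons w j) `<=` \bigcup_m A m,
    (n <= e)%N & e%:R <= n%:R * expR (i%:R * (x1 + x2))].
  elim: i => [_|i IHi ir].
    by exists (fun=> set0), n; split=> //; rewrite mul0r expR0 mulr1.
  have [A [e [HA cA ne eE]]] := IHi (ltnW ir).
  set n1 := (e + Num.truncn (g * e%:R / ra))%N.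
  have n1E : n1%:R <= e%:R * expR x2.
    rewrite /n1 natrD; apply: (@le_trans _ _ (e%:R * (1 + x2))); last first.
      by rewrite ler_wpM2l// expR_ge1Dx.
    rewrite mulrDr mulr1 lerD2l (_ : e%:R * x2 = g * e%:R / ra).
      by rewrite truncn_le mulr_ge0 ?invr_ge0 ?(ltW ra0)// mulr_ge0// ltW.
    by rewrite /x2; ring.
  have n1le : n1%:R * expR x1 <= n%:R * expR (i.+1%:R * (x1 + x2)).
    have -> : i.+1%:R * (x1 + x2) = i%:R * (x1 + x2) + x2 + x1.
      by rewrite -natr1; ring.
    rewrite !expRD !mulrA ler_wpM2r ?expR_ge0//; apply: (le_trans n1E).
    by rewrite ler_wpM2r ?expR_ge0.
  have sz : size (rcons w (Ordinal ir)) = (size w).+1 by rewrite size_rcons.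
  have := IH (rcons w (Ordinal ir)) n1; rewrite sz exprS -/ra -/x1.
  case=> //.
  - apply: (le_trans ga); rewrite ler_peMl ?(ltW ra0)//.
    by rewrite ler1n ltnW.
  (* That [w] is too large to be served at time [n] is, up to a factor [r], the lower bound required
     for its children. *)
  - rewrite mulrCA -mulrA ler_wpM2l ?(ltW r_gt0)//.
    apply: (le_trans (ltW hi)); rewrite ler_wpM2l ?(ltW rho_gt0)// ler_nat.
    by rewrite (leq_trans ne)// leq_addr.
  - rewrite addSnnS; apply: le_trans up; rewrite -!mulrA.
    rewrite ler_wpM2l ?(ltW rho_gt0)//; apply: (le_trans n1le).
    rewrite ler_wpM2l// ler_expR ler_wpM2r ?addr_ge0//.
    by rewrite ler_nat.
  move=> A1 [e1 [HA1 cA1 n1e1 e1E]].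
  exists (fun m => A m `|` A1 m), e1; split.
  - apply: (schedule_cat _ ne _ n1e1 HA) => //; first exact: leq_addr.
    + by apply: schedule_sub HA1 => //; exact: L_nested.
    + by move=> m m' x y *; apply: (gap_cross (w := w) (e := e)).
  - move=> j; rewrite ltnS leq_eqVlt => /predU1P[ji|ji] x Hx.
      have jE : j = Ordinal ir by apply: val_inj.
      by rewrite jE in Hx; have [m _ Am] := cA1 _ Hx; exists m => //; right.
    by have [m _ Am] := cA _ ji _ Hx; exists m => //; left.
  - by rewrite (leq_trans ne)// (leq_trans _ n1e1)// leq_addr.
  - exact: le_trans n1le.
have [A [e [HA cA ne eE]]] := children r (leqnn r).
by exists A, e; split=> // x [j _]; exact: cA.
Qed.

(** Let x = g r / r^|w| <= 1/4. A search to depth k multiplies the time by a constant times e^(xk),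
    and e^x <= 4/3 < 2 <= r, so some k meets the size condition of [schedule_level_cover]. *)
Lemma exists_schedule (w : seq 'I_r) n0 : (0 < size w)%N ->
  4 * g * r%:R <= r%:R ^+ size w ->
  exists k n A e, [/\ (n0 <= n)%N, schedule tau D N n e (L w) A &
    level_cover k w `<=` \bigcup_m A m].
Proof.
move=> w0 gr.
have ra0 : 0 < r%:R ^+ size w :> R by rewrite exprn_gt0.
set n := maxn n0 (Num.truncn (tau * r%:R ^+ size w / (r%:R * rho))).+1.
have rr : 1 <= r%:R :> R by rewrite ler1n ltnW.
have ga : g <= r%:R ^+ size w.
  apply: le_trans gr; rewrite -mulrA mulrCA ler_peMr ?(ltW g_gt0)//.
  by lra.
have lo : tau * r%:R ^+ size w <= r%:R * rho * n%:R.
  rewrite -ler_pdivrMl ?mulr_gt0// mulrC.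
  apply: le_trans (_ : (Num.truncn (tau * r%:R ^+ size w / (r%:R * rho))).+1%:R <= _).
    by rewrite ltW// truncnS_gt.
  by rewrite ler_nat leq_maxr.
have [k kE] : exists k, rho * n%:R * expR ((g * r%:R * k%:R + B) / r%:R ^+ size w)
    <= tau * r%:R ^+ (size w + k).
  set ra := _ ^+ size w in gr ra0 ga lo *.
  set x := g * r%:R / ra.
  have x4 : x <= 1 / 4.
    by rewrite /x ler_pdivrMr//; lra.
  have ex : expR x <= 4 / 3.
    have h1 := expR_ge1Dx (- x); have h2 := expRxMexpNx_1 x.
    have := expR_gt0 x; have := expR_gt0 (-x); nra.
  (* [K] is the factor missing at k = 0. In 2^k = (3/2)^k (4/3)^k the first power makes up for [K],
     the second for e^(xk). *)
  set K := rho * n%:R * expR (B / ra) / (tau * ra).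
  have [k Kk] : exists k, K <= (3 / 2) ^+ k.
    have bern m : 1 + m%:R / 2 <= (3 / 2) ^+ m :> R.
      elim: m => [|m IHm]; first by rewrite expr0 mul0r addr0.
      have m_ge0 : 0 <= m%:R :> R by [].
      by rewrite exprS -natr1; nra.
    exists (Num.truncn (2 * K)).+1; apply: le_trans (bern _).
    by have := truncnS_gt (2 * K); lra.
  exists k.
  have -> : (g * r%:R * k%:R + B) / ra = x * k%:R + B / ra.
    by rewrite /x; ring.
  rewrite expRD expRM_natr exprD.
  apply: (@le_trans _ _ (K * (tau * ra) * (4 / 3) ^+ k)).
    rewrite /K divfK ?gt_eqF ?mulr_gt0// -!mulrA [_ * expR _]mulrC.
    rewrite !ler_wpM2l ?(ltW rho_gt0) ?expR_ge0//.
    by apply: lerXn2r; rewrite ?nnegrE ?expR_ge0.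
  have tra_ge0 : 0 <= tau * ra by rewrite mulr_ge0 ?ltW.
  apply: (@le_trans _ _ (tau * ra * ((3 / 2) ^+ k * (4 / 3) ^+ k))).
    by rewrite mulrAC mulrC ler_wpM2l// ler_wpM2r// exprn_ge0.
  rewrite -exprMn (_ : 3 / 2 * (4 / 3) = 2); last by field.
  rewrite [leRHS]mulrA ler_wpM2l//.
  by apply: lerXn2r; rewrite ?nnegrE ?ler_nat.
have [A [e [HA cA _ _]]] := schedule_level_cover w0 ga lo kE.
by exists k, n, A, e; split => //; exact: leq_maxl.
Qed.

End Schedule.

(** * F-spaces and Baire's theorem *)

Section FSpaceTheory.
Context (R : realType) (K : numFieldType) (X : fspaceType R K).
Implicit Types x y z : X.

Lemma fdistxx x : fdist x x = 0. Proof. exact/fdist_eq0. Qed.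

Lemma fdistE x y : fdist x y = fnorm (x - y).
Proof. by rewrite -(fdist_translation x y (- y)) subrr. Qed.

Lemma fnorm_triangle x y : fnorm (x + y) <= fnorm x + fnorm y.
Proof.
have := fdist_triangle y (x + y) 0; rewrite -/(fnorm y) => H.
by rewrite {2}/fnorm -(fdist_translation x 0 y) add0r.
Qed.

Lemma fnorm_sum I (s : seq I) (P : pred I) (F : I -> X) :
  fnorm (\sum_(i <- s | P i) F i) <= \sum_(i <- s | P i) fnorm (F i).
Proof.
elim/big_ind2: _ => //; first by rewrite /fnorm fdistxx.
by move=> x1 x2 y1 y2 H1 H2; apply: le_trans (fnorm_triangle _ _) (lerD _ _).
Qed.

Lemma fball_nbhs x (e : R) : 0 < e -> nbhs x [set y | fdist x y < e].
Proof. by move=> e0; apply/fdist_nbhs; exists e. Qed.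

Lemma fball_open x (e : R) : open [set y | fdist x y < e].
Proof.
rewrite openE => y /= xy; apply/fdist_nbhs; exists (e - fdist x y).
  by rewrite subr_gt0.
by move=> z /= yz; have := fdist_triangle y x z; lra.
Qed.

Lemma open_fball (O : set X) x : open O -> O x ->
  exists2 e : R, 0 < e & [set y | fdist x y < e] `<=` O.
Proof. by move=> oO Ox; apply/fdist_nbhs; exact: open_nbhs_nbhs. Qed.

Lemma dense_fball (A : set X) x (e : R) : dense A -> 0 < e ->
  exists2 y, A y & fdist x y < e.
Proof.
move=> dA e0; have [|y [? ?]] := dA _ _ (fball_open x e); last by exists y.
by exists x; rewrite /= fdistxx.
Qed.

(** Closed balls are nested, each inside the preceding open ball and [F n], with radii at most
    1/(n+1). The centres form a Cauchy sequence, whose limit lies in every ball. *)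
Theorem fspace_Baire (F : nat -> set X) :
  (forall n, open (F n)) -> (forall n, dense (F n)) -> dense (\bigcap_n F n).
Proof.
move=> oF dF O [x0 Ox0] oO.
have [e0 e0_gt0 e0O] := open_fball oO Ox0.
(* A state is a centre and a radius; allowing any successor when the radius is not positive makes
   the choice function total. *)
have step n (p : X * R) : exists q : X * R, 0 < p.2 ->
    [/\ 0 < q.2, q.2 * n.+1%:R <= 1 &
      forall y, fdist q.1 y <= q.2 -> F n y /\ fdist p.1 y < p.2].
  have [p2|p2] := ltP 0 p.2; last by exists p; rewrite ltNge p2.
  have [y [py Fy]] : [set y | fdist p.1 y < p.2] `&` F n !=set0.
    by apply: dF (fball_open _ _); exists p.1; rewrite /= fdistxx.
  have [e e_gt0 eS] := open_fball (openI (fball_open _ _) (oF n)) (conj py Fy).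
  exists (y, Num.min (e / 2) n.+1%:R^-1) => _ /=; split.
  - by rewrite lt_min invr_gt0 ltr0n andbT divr_gt0.
  - by rewrite -ler_pdivlMr// mul1r ge_min lexx orbT.
  - move=> z; rewrite le_min => /andP[yz _].
    by have [] : [set y | fdist p.1 y < p.2] z /\ F n z by apply: eS => /=; lra.
have /choice[f fP] : forall np : nat * (X * R), exists q : X * R, 0 < np.2.2 ->
    [/\ 0 < q.2, q.2 * np.1.+1%:R <= 1 &
      forall y, fdist q.1 y <= q.2 -> F np.1 y /\ fdist np.2.1 y < np.2.2].
  by move=> [n p]; exact: step.
pose s := fix s n := if n is m.+1 then f (m, s m) else (x0, e0 / 2).
have s_gt0 n : 0 < (s n).2.
  by elim: n => [|n IH] /=; [rewrite divr_gt0|have [] := fP (n, s n) IH].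
have sP n : [/\ 0 < (s n.+1).2, (s n.+1).2 * n.+1%:R <= 1 &
    forall y, fdist (s n.+1).1 y <= (s n.+1).2 ->
      F n y /\ fdist (s n).1 y < (s n).2].
  exact: (fP (n, s n) (s_gt0 n)).
have nest m n y : fdist (s (n + m)%N).1 y <= (s (n + m)%N).2 ->
    fdist (s n).1 y <= (s n).2.
  elim: m => [|m IH]; first by rewrite addn0.
  by rewrite addnS => H; apply/IH/ltW; have [_ _ /(_ y H)[]] := sP (n + m)%N.
have sin m n : (n <= m)%N -> fdist (s n).1 (s m).1 <= (s n).2.
  move=> nm; apply: (nest (m - n)%N); rewrite subnKC//.
  by rewrite fdistxx ltW.
have small (e : R) : 0 < e -> exists n, (s n).2 < e.
  move=> e_gt0; exists (Num.truncn e^-1).+1; have [_ H _] := sP (Num.truncn e^-1).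
  have t := truncnS_gt e^-1; rewrite -ler_pdivlMr// mul1r in H.
  by apply: le_lt_trans H _; rewrite invf_plt ?posrE.
have [|x sx] := @fdist_complete _ _ X (fun n => (s n).1).
  move=> e e_gt0; have [N sN] := small (e / 2) (divr_gt0 e_gt0 (ltr0n _ 2)).
  exists N => m n Nm Nn; have := sin _ _ Nm; have := sin _ _ Nn.
  have := fdist_triangle (s N).1 (s m).1 (s n).1.
  by rewrite (fdist_sym (s m).1 (s N).1); lra.
have xin n : fdist (s n).1 x <= (s n).2.
  apply/ler_addgt0Pr => e e_gt0.
  have [N _ HN] := sx _ (fball_nbhs x e_gt0).
  have := HN _ (leq_maxl N n); have := sin _ _ (leq_maxr N n) => /=.
  have := fdist_triangle (s (maxn N n)).1 (s n).1 x.
  by rewrite (fdist_sym (s (maxn N n)).1 x); lra.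
exists x; split; last by move=> n _; have [_ _ /(_ x (xin _))[]] := sP n.
by apply: e0O; have := xin 0%N => /=; lra.
Qed.

End FSpaceTheory.

(** * Tails of series and real powers *)

Section RealLemmas.
Context {R : realType}.

Lemma summable_tail (c : nat -> R) : (forall k, 0 <= c k) ->
  cvgn (series c) -> forall e, 0 < e ->
  exists N, forall n, \sum_(N <= i < n) c i <= e.
Proof.
move=> c0 cc e e0.
have nd : nondecreasing_seq (series c) by apply: nondecreasing_series.
have [N _ HN] : \forall n \near \oo, `|limn (series c) - series c n| < e.
  by move/cvgrPdist_lt: cc; apply.
exists N => n; have [nN|/ltnW Nn] := leqP n N; first by rewrite big_geq// ltW.
rewrite -[leLHS](addKr (series c N)).
have -> : series c N + \sum_(N <= i < n) c i = series c n.
  by rewrite /series /= -big_cat_nat.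
have := nondecreasing_cvgn_le nd cc n; have := HN N (leqnn N).
by move=> /ltr_normlW; lra.
Qed.

(** Served times have distinct gaps to a fixed time, all at least [N]; reindexing by the gaps bounds
    the sum by a segment of a tail. *)
Lemma ler_sum_inj (c : nat -> R) (e N M : nat) (P : pred nat) (f : nat -> nat) :
  (forall k, 0 <= c k) ->
  (forall j, (j < e)%N -> P j -> (N <= f j < M)%N) ->
  (forall i j, (i < e)%N -> P i -> (j < e)%N -> P j -> f i = f j -> i = j) ->
  \sum_(j < e | P j) c (f j) <= \sum_(N <= i < M) c i.
Proof.
move=> c0 fb fi; rewrite -(big_mkord P (fun j => c (f j))) -big_filter.
rewrite -(big_map f predT c); set s := map _ _.
have sP j : j \in [seq j <- index_iota 0 e | P j] -> (j < e)%N /\ P j.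
  by rewrite mem_filter mem_index_iota => /andP[-> /andP[]].
have us : uniq s.
  rewrite map_inj_in_uniq; first by rewrite filter_uniq ?iota_uniq.
  by move=> i j /sP[? ?] /sP[? ?]; exact: fi.
have sub i : i \in s -> (N <= i < M)%N.
  by move=> /mapP[j /sP[? ?] ->]; exact: fb.
rewrite (perm_big [seq i <- index_iota N M | i \in s]) /=; last first.
  rewrite uniq_perm ?filter_uniq ?iota_uniq// => i.
  rewrite mem_filter mem_index_iota.
  by case: (boolP (i \in s)) => //= /sub ->.
by rewrite big_filter big_mkcond ler_sum// => i _; case: ifP.
Qed.

(** Raising to the power 1 / gam recovers the distance condition of CS1, and with b = 1 that of CS2,
    from the form used in [schedule]. *)
Lemma powR_gap (gam z D a b : R) : 0 < gam -> 0 <= z -> 0 <= D -> 0 < a ->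
  0 <= b -> z `^ gam * a <= D `^ gam * b ->
  z <= D * (b `^ (1 / gam) / a `^ (1 / gam)).
Proof.
move=> g0 z0 D0 a0 b0 H.
have gi : 0 <= 1 / gam by rewrite divr_ge0// ltW.
have Z y : 0 <= y -> (y `^ gam) `^ (1 / gam) = y.
  by move=> y0; rewrite -powRrM mulrC divfK ?gt_eqF// powRr1.
rewrite mulrA ler_pdivlMr ?powR_gt0//.
have := ge0_ler_powR gi _ _ H; rewrite !nnegrE !powRM ?powR_ge0// ?(ltW a0)//.
by rewrite !Z//; apply; rewrite mulr_ge0 ?powR_ge0// ltW.
Qed.

End RealLemmas.

(** * From schedules to approximating vectors *)

Section Approximation.
Context (R : realType) (K : numFieldType) (X : fspaceType R K) (d : nat).
Variables (gam : R) (Lam : set 'rV[R]_d) (T : nat -> 'rV[R]_d -> X -> X).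
Hypothesis gam_gt0 : 0 < gam.
Hypothesis opT : operator_family Lam T.

Let psi (x y : 'rV[R]_d) : R := `|x - y| `^ gam.

Lemma operator_family_sum n l I (s : seq I) (P : pred I) (F : I -> X) x :
  (0 < n)%N -> Lam l ->
  T n l (x + \sum_(i <- s | P i) F i) = T n l x + \sum_(i <- s | P i) T n l (F i).
Proof.
move=> n0 Ll; have [lT _] := opT.2 n l n0 Ll.
have TD y z : T n l (y + z) = T n l y + T n l z.
  by have := lT 1 y z; rewrite !scale1r.
have T0 : T n l 0 = 0 by apply: (addrI (T n l 0)); rewrite -TD !addr0.
by rewrite TD (big_morph _ TD T0).
Qed.

Variables (DD : set X) (S : nat -> 'rV[R]_d -> X -> X) (D : R).
Hypothesis TS : right_inverse_family Lam DD T S.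
Hypothesis D_gt0 : 0 < D.
Hypothesis hCS1 : forall u, DD u -> CS1 Lam gam D T S u.
Hypothesis hCS2 : forall u, DD u -> CS2 Lam gam T S u.

(** In CS1 with n = 0 and equal parameters, one of the two maps is the identity. The bound on [T]
    controls the images of [v0], that on [S] the correction added to [v0]. *)
Lemma CS1_at0 u : DD u -> exists (kappa : nat) (c : nat -> R),
  [/\ forall k, 0 <= c k, cvgn (series c) &
    forall k l, (kappa <= k)%N -> Lam l ->
      fnorm (T k l u) <= c k /\ fnorm (S k l u) <= c k].
Proof.
move=> Du; have [kappa [c [k0 c0 cc H]]] := hCS1 Du.
exists kappa, c; split=> // [k|k l kk Ll]; first exact: ltW.
have := H 0%N k l l kk Ll Ll; rewrite subrr normr0 add0n.
rewrite TS.1// opT.1//; apply.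
by rewrite mulr_ge0 ?divr_ge0 ?powR_ge0// ltW.
Qed.

Lemma CS1_psi u : DD u -> exists (kappa : nat) (c : nat -> R),
  [/\ forall k, 0 <= c k, cvgn (series c),
    forall m j l mu, (m + kappa <= j)%N -> (0 < j)%N -> Lam l -> Lam mu ->
      psi l mu * j%:R <= D `^ gam * (j - m)%:R ->
      fnorm (T j l (S m mu u)) <= c (j - m)%N &
    forall m j l mu, (m + kappa <= j)%N -> (0 < j)%N -> Lam l -> Lam mu ->
      psi l mu * j%:R <= D `^ gam * (j - m)%:R ->
      fnorm (T m l (S j mu u)) <= c (j - m)%N].
Proof.
move=> Du; have [kappa [c [k0 c0 cc H]]] := hCS1 Du.
exists kappa, c; split=> // [k|m j l mu mj j0 Ll Lmu jm|m j l mu mj j0 Ll Lmu jm].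
- exact: ltW.
- have mj' : (m <= j)%N by lia.
  have := H m (j - m)%N l mu _ Ll Lmu; rewrite subnKC//; case=> //; first by lia.
  by apply: powR_gap jm; rewrite ?ltr0n// ltW.
- have mj' : (m <= j)%N by lia.
  have := H m (j - m)%N l mu _ Ll Lmu; rewrite subnKC//; case=> //; first by lia.
  by apply: powR_gap jm; rewrite ?ltr0n// ltW.
Qed.

Lemma CS2_psi u eta : DD u -> 0 < eta -> exists2 tau : R, 0 < tau &
  forall n l mu, (0 < n)%N -> Lam l -> Lam mu ->
    psi l mu * n%:R <= tau -> fnorm (T n l (S n mu u) - u) <= eta.
Proof.
move=> Du eta0; have [tau tau0 H] := hCS2 Du eta0.
exists (tau `^ gam); first exact: powR_gt0.
move=> n l mu n0 Ll Lmu nl; apply: H => //.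
have := @powR_gap R gam `|l - mu| tau n%:R 1 gam_gt0.
by rewrite powR1 mulr1 [1 / _ `^ _]div1r; apply; rewrite ?ltr0n// ltW.
Qed.

Lemma schedule_approx v0 v eta : DD v0 -> DD v -> 0 < eta ->
  exists N (tau : R), [/\ (0 < N)%N, 0 < tau &
    forall A U n e, (N <= n)%N -> U `<=` Lam ->
      schedule psi tau (D `^ gam) N n e U A ->
      exists2 u, fnorm (u - v0) <= eta &
        forall m l, A m l -> fnorm (T m l u - v) <= eta].
Proof.
(* [T m l u - v] takes four shares eta / 5: the image of [v0], the diagonal term, the earlier times
   and the later times. *)
move=> Dv0 Dv eta0; have eta5 : 0 < eta / 5 by lra.
have [k0 [c0 [c0_ge0 cc0 H0]]] := CS1_at0 Dv0.
have [k1 [c1 [c1_ge0 cc1 H1]]] := CS1_at0 Dv.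
have [k2 [c [c_ge0 cc Hdown Hup]]] := CS1_psi Dv.
have [tau tau0 Htau] := CS2_psi Dv eta5.
have [N0 HN0] := summable_tail c0_ge0 cc0 eta5.
have [N1 HN1] := summable_tail c1_ge0 cc1 eta5.
have [N2 HN2] := summable_tail c_ge0 cc eta5.
(* Gaps of at least [N] are admissible in CS1 and index terms of the small tails. *)
have [N [N_gt0 [N0N N1N N2N] [k0N k1N k2N]]] : exists N, [/\ (0 < N)%N,
    [/\ N0 <= N, N1 <= N & N2 <= N]%N & [/\ k0 <= N, k1 <= N & k2 <= N]%N].
  by exists (N0 + N1 + N2 + k0 + k1 + k2).+1; split; [|split|split]; lia.
exists N, tau; split=> // A U n e Nn UL [a1 a2 a3].
have {}a1 m x : A m x -> [/\ (N <= m)%N, (m + N <= e)%N & Lam x].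
  by move=> /a1[? ? /UL ?]; split=> //; exact: leq_trans Nn _.
(* Where [A m] is empty, [p m] is the default 0; [P] keeps such times out of the sum. *)
pose p m := xget 0 (A m).
pose P m := `[< A m !=set0 >].
have pP m : P m -> A m (p m) by move=> /asboolP[x Ax]; apply: xgetPex; exists x.
have tail (cc' : nat -> R) N' M : (forall k, 0 <= cc' k) -> (N' <= N)%N ->
    \sum_(N <= i < M) cc' i <= \sum_(N' <= i < M) cc' i.
  move=> cp NN; have [MN|NM] := leqP M N; first by rewrite big_geq// sumr_ge0.
  by rewrite (big_cat_nat NN (ltnW NM)) /= lerDr sumr_ge0.
exists (v0 + \sum_(j < e | P j) S j (p j) v).
  rewrite addrC addKr; apply: le_trans (fnorm_sum _ _ _) _.
  apply: (@le_trans _ _ (\sum_(j < e | P j) c1 j)).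
    apply: ler_sum => j /pP/a1[Nj ? ?]; apply: (H1 _ _ _ _).2 => //.
    exact: leq_trans Nj.
  apply: (@le_trans _ _ (\sum_(N <= i < e) c1 i)).
    by apply: (@ler_sum_inj _ c1 e N e P id) => // j je /pP/a1[-> _ _].
  apply: (@le_trans _ _ (eta / 5)); last by lra.
  by apply: le_trans (tail c1 N1 e _ _) (HN1 e).
move=> m l Aml; have [Nm me Ll] := a1 _ _ Aml.
have m0 : (0 < m)%N by apply: leq_trans Nm.
have Pm : P m by apply/asboolP; exists l.
have lt_me : (m < e)%N by apply: leq_trans me; rewrite -addn1 leq_add2l.
rewrite operator_family_sum// (bigD1 (Ordinal lt_me))//=.
set s := \sum_(j < e | _) _.
have -> : T m l v0 + (T m l (S m (p m) v) + s) - v =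
    T m l v0 + ((T m l (S m (p m) v) - v) + s).
  by rewrite -addrA [_ + s - v]addrAC.
have t0 : fnorm (T m l v0) <= eta / 5.
  apply: le_trans (H0 m l (leq_trans k0N Nm) Ll).1 _.
  have N0m : (N0 <= m)%N := leq_trans N0N Nm.
  apply: le_trans (HN0 m.+1); rewrite big_nat_recr//= lerDr.
  exact: sumr_ge0.
have t1 : fnorm (T m l (S m (p m) v) - v) <= eta / 5.
  have [_ _ Lp] := a1 _ _ (pP _ Pm).
  by apply: Htau => //; apply: a2 (pP _ Pm).
have t2 : fnorm s <= eta / 5 + eta / 5.
  (* For j < m the first bound of CS1 applies, with gap m - j; for j > m the second, with gap j -
     m. *)
  rewrite /s (bigID (fun j : 'I_e => (j < m)%N)) /=.
  apply: le_trans (fnorm_triangle _ _) (lerD _ _).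
  - apply: le_trans (fnorm_sum _ _ _) _.
    apply: (@le_trans _ _ (\sum_(j < e | P j && (j < m)%N) c (m - j)%N)).
      rewrite [leRHS](eq_bigl (fun j : 'I_e =>
        (P j && (j != Ordinal lt_me)) && (j < m)%N)); last first.
        move=> j /=; rewrite -(inj_eq val_inj) /=.
        by case: ltngtP => //; rewrite ?andbT ?andbF.
      apply: ler_sum => j /andP[/andP[/pP Aj _] jm].
      have [jN jeq Lj] := a1 _ _ Aj; have [jNm H] := a3 _ _ _ _ Aj Aml jm.
      apply: (Hdown _ _ _ _ _ m0 Ll Lj); last by rewrite /psi distrC; exact: H.
      by apply: leq_trans jNm; rewrite leq_add2l.
    apply: (@le_trans _ _ (\sum_(N <= i < m.+1) c i)).
      apply: (@ler_sum_inj _ c e N m.+1 (fun j => P j && (j < m)%N)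
        (fun j => m - j)%N) => //.
      + move=> j _ /andP[/pP Aj jm]; have [jNm _] := a3 _ _ _ _ Aj Aml jm.
        by rewrite ltnS leq_subr andbT leq_subRL// ltnW.
      + move=> i j _ /andP[_ im] _ /andP[_ jm] ij.
        by rewrite -(subKn (ltnW im)) ij subKn// ltnW.
    by apply: le_trans (tail c N2 m.+1 _ _) (HN2 m.+1).
  - apply: le_trans (fnorm_sum _ _ _) _.
    apply: (@le_trans _ _ (\sum_(j < e | P j && (m < j)%N) c (j - m)%N)).
      rewrite [leRHS](eq_bigl (fun j : 'I_e =>
        (P j && (j != Ordinal lt_me)) && ~~ (j < m)%N)); last first.
        move=> j /=; rewrite -(inj_eq val_inj) /=.
        by case: ltngtP => //; rewrite ?andbT ?andbF.
      apply: ler_sum => j /andP[/andP[/pP Aj]]; rewrite -(inj_eq val_inj) /=.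
      move=> jm1; rewrite -leqNgt leq_eqVlt eq_sym (negPf jm1) => /= jm.
      have [jN jeq Lj] := a1 _ _ Aj; have [jNm H] := a3 _ _ _ _ Aml Aj jm.
      apply: (Hup _ _ _ _ _ (leq_trans _ jm) Ll Lj H) => //.
      by apply: leq_trans jNm; rewrite leq_add2l.
    apply: (@le_trans _ _ (\sum_(N <= i < e) c i)).
      apply: (@ler_sum_inj _ c e N e (fun j => P j && (m < j)%N)
        (fun j => j - m)%N) => //.
      + move=> j je /andP[/pP Aj jm]; have [jNm _] := a3 _ _ _ _ Aml Aj jm.
        by rewrite (leq_ltn_trans (leq_subr _ _) je) andbT leq_subRL// ltnW.
      + move=> i j _ /andP[_ im] _ /andP[_ jm] ij.
        by rewrite -(subnK (ltnW im)) ij subnK// ltnW.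
    by apply: le_trans (tail c N2 e _ _) (HN2 e).
apply: le_trans (fnorm_triangle _ _) _.
have := fnorm_triangle (T m l (S m (p m) v) - v) s; lra.
Qed.

(** By joint continuity, a time that works at (l, u) works at nearby (l', u'); compactness of [C]
    makes the neighbourhood of [u] uniform in [l]. *)
Lemma universal_open (cT : continuous_family Lam T) (C : set 'rV[R]_d)
    (O : set X) : compact C -> C `<=` Lam -> open O ->
  open [set u | forall l, C l -> exists2 n, (0 < n)%N & O (T n l u)].
Proof.
move=> /compact_near_coveringP cC CL oO; rewrite openE => u Hu.
(* The guard [Lam l] is there because continuity holds only within [Lam]. *)
pose P u' l := Lam l -> exists2 n, (0 < n)%N & O (T n l u').
apply: filterS (cC _ (nbhs u) P _ _) => [u' H l Cl|].
  exact: H Cl (CL _ Cl).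
move=> l Cl; have [n n0 OT] := Hu _ Cl.
have /subspace_continuousP/(_ (l, u)) := cT n n0.
move=> /(_ (conj (CL _ Cl) I) _ (open_nbhs_nbhs (conj oO OT))) [W W1 W2].
exists W => // -[l' u'] /W2 /= H Ll'; exists n => //.
exact: H.
Qed.

End Approximation.

(** * Points followed along the tree of words *)

Section WordCovers.
Context (r : nat) (P : Type) (L : seq 'I_r -> set P).

Lemma level_cover_cat (w v : seq 'I_r) : L (w ++ v) `<=` level_cover L (size v) w.
Proof.
elim: v w => [|j v IH] w; first by rewrite cats0; exact: subset_refl.
by rewrite -cat_rcons => x Hx; exists j => //; exact: IH.
Qed.

Hypothesis L_nested :
  forall (w : seq 'I_r) j, (0 < size w)%N -> L (rcons w j) `<=` L w.

Lemma level_cover_anti (w : seq 'I_r) k k' : (0 < size w)%N -> (k <= k')%N ->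
  level_cover L k' w `<=` level_cover L k w.
Proof.
move=> w0; elim: k' => [|k' IH]; first by rewrite leqn0 => /eqP->; exact: subset_refl.
rewrite leq_eqVlt => /predU1P[->|kk']; [exact: subset_refl|apply: subset_trans (IH kk')].
exact: level_coverS.
Qed.

(** Words of length [a] are finitely many. If each lost [x] at some depth, a longer word, of length
    [a] plus the largest such depth, with [x] in its piece would give a contradiction, as the covers
    decrease with depth. *)
Lemma branch_cover (a : nat) x : (0 < a)%N ->
  (forall m, (0 < m)%N -> exists2 i, size i = m & L i x) ->
  exists2 w, size w = a & forall k, level_cover L k w x.
Proof.
move=> a0 Lx; apply: contrapT => H.
have /choice[K HK] : forall w : a.-tuple 'I_r, exists k, ~ level_cover L k w x.
  move=> w; apply: contrapT => /forallNP Hw; apply: H; exists w.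
    exact: size_tuple.
  by move=> k; apply: contrapT; exact: Hw.
pose M := \max_(w : a.-tuple 'I_r) K w.
have [i si Li] := Lx (a + M)%N (leq_trans a0 (leq_addr _ _)).
have sw : size (take a i) == a by rewrite size_takel// si leq_addr.
apply: (HK (Tuple sw)); apply: (@level_cover_anti _ _ M).
- by rewrite /= (eqP sw).
- exact: (leq_bigmax (F := K)).
- have -> : M = size (drop a i) by rewrite size_drop si addKn.
  by apply: level_cover_cat; rewrite /= cat_take_drop.
Qed.

End WordCovers.

Lemma level_cover_closed (r : nat) (P : topologicalType) (L : seq 'I_r -> set P)
    k (w : seq 'I_r) : (forall v, (0 < size v)%N -> closed (L v)) ->
  (0 < size w)%N -> closed (level_cover L k w).
Proof.
move=> cL; elim: k w => [|k IH] w w0; first exact: cL.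
apply: closed_bigcup => [|j _]; first exact: finite_finset.
by apply: IH; rewrite size_rcons.
Qed.

Lemma countable_dense_seq (X : topologicalType) (x0 : X) : separable X ->
  exists q : nat -> X, dense (range q).
Proof.
move=> [Q [cQ dQ]]; have /pfcard_geP[Q0|/unsquash f] := cQ.
  have [|x [_]] := dQ setT _ openT; first by exists x0.
  by rewrite Q0.
exists f => O O0 oO; have [x [Ox Qx]] := dQ O O0 oO; exists x; split => //.
by have [n _ <-] := @surj _ _ _ _ f x Qx; exists n.
Qed.

(** * The criterion via Baire's theorem *)

Theorem theorem2p1 (R : realType) (K : numFieldType) (X : fspaceType R K)
    (sepX : separable X)
    (d : nat) (d_gt0 : (0 < d)%N) (gam : R) (gam_gt0 : 0 < gam)
    (Lam : set 'rV[R]_d) (cLam : compact Lam) (hLam : HBDo_le Lam gam)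
    (T : nat -> 'rV[R]_d -> X -> X)
    (opT : operator_family Lam T) (cT : continuous_family Lam T)
    (DD : set X) (dDD : dense DD) (S : nat -> 'rV[R]_d -> X -> X)
    (TS : right_inverse_family Lam DD T S)
    (D : R) (D_gt0 : 0 < D)
    (hCS1 : forall u, DD u -> CS1 Lam gam D T S u)
    (hCS2 : forall u, DD u -> CS2 Lam gam T S u) :
  dense (common_universal Lam T) /\ Gdelta (common_universal Lam T).
Proof.
have [_ [_ [r [rho [L0 [[r2 rho0 Lcov Lcpt] [Ldiam Lnest _]]]]]]] := hLam.
pose psi (x y : 'rV[R]_d) : R := `|x - y| `^ gam.
(* The covering sets may leave [Lam], the only place where the hypotheses on the operators hold. *)
pose L w := L0 w `&` Lam.
have L_nested w j : (0 < size w)%N -> L (rcons w j) `<=` L w.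
  by move=> w0 x [/(Lnest _ _ w0) ? ?].
have L_closed w : (0 < size w)%N -> closed (L w).
  by move=> w0; apply: closedI; apply: compact_closed => //; exact: Lcpt.
have r_gt0 : 0 < r%:R :> R by rewrite ltr0n ltnW.
have L_small w x y : (0 < size w)%N -> L w x -> L w y ->
    psi x y * r%:R ^+ size w <= rho `^ gam.
  move=> w0 [Lx _] [Ly _].
  have q0 : 0 < r%:R `^ (1 / gam) :> R by rewrite powR_gt0.
  have H : `|x - y| <= rho * (1 / r%:R `^ (1 / gam)) ^+ size w.
    rewrite -lee_fin; apply: le_trans (Ldiam _ w w0 erefl).
    by apply: ereal_sup_ubound; exists x => //; exists y.
  rewrite expr_div_n expr1n mulrA mulr1 ler_pdivlMr ?exprn_gt0// in H.
  have qE : (r%:R `^ (1 / gam)) `^ gam = r%:R :> R.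
    by rewrite -powRrM divfK ?gt_eqF// powRr1// ltW.
  have rE : ((r%:R `^ (1 / gam)) ^+ size w) `^ gam = r%:R ^+ size w :> R.
    by rewrite -powR_mulrn ?powR_ge0// powRAC qE powR_mulrn// ltW.
  rewrite -rE /psi -powRM ?exprn_ge0 ?(ltW q0)//.
  apply: (ge0_ler_powR (ltW gam_gt0) _ _ H); rewrite nnegrE.
    by rewrite mulr_ge0.
  exact: ltW.
pose g := 2 * rho `^ gam / D `^ gam.
(* The length [a] is fixed before [N] and [tau]: the condition on it in [exists_schedule] involves
   neither. *)
have [a a0 ga] : exists2 a, (0 < a)%N & 4 * g * r%:R <= r%:R ^+ a.
  exists (Num.truncn (4 * g * r%:R)).+1 => //.
  apply: (ltW (lt_le_trans (truncnS_gt _) _)).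
  by rewrite -natrX ler_nat ltnW// ltn_expl.
(* The depth of a schedule varies with the vectors to be approximated; a point of [C w] lies in the
   covers of all depths. *)
pose C w := \bigcap_k level_cover L k w.
have C_sub w : (0 < size w)%N -> C w `<=` Lam.
  by move=> w0 x /(_ 0%N I) [].
have C_cpt w : (0 < size w)%N -> compact (C w).
  move=> w0; apply: subclosed_compact cLam (C_sub _ w0).
  by apply: closed_bigI => k _; exact: level_cover_closed.
have C_cov l : Lam l -> exists2 w, size w = a & C w l.
  move=> Ll; have [|w wa Hw] := @branch_cover _ _ L L_nested a l a0.
    by move=> m m0; have [i im Li] := Lcov m m0 l Ll; exists i.
  by exists w => // k _; exact: Hw.
have [q dq] := countable_dense_seq (0 : X) sepX.
pose U i p w := [set u : X | forall l, C w l ->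
  exists2 n, (0 < n)%N & fdist (q i) (T n l u) < p.+1%:R^-1].
have U_open i p w : (0 < size w)%N -> open (U i p w).
  move=> w0.
  exact: (universal_open cT (C_cpt _ w0) (C_sub _ w0)
    (fball_open (q i) p.+1%:R^-1)).
have U_dense i p w : size w = a -> dense (U i p w).
  move=> wa O [y Oy] oO; have w0 : (0 < size w)%N by rewrite wa.
  have [v0 [Ov0 Dv0]] : O `&` DD !=set0 by apply: dDD => //; exists y.
  have [e e0 eO] := open_fball oO Ov0.
  have p0 : 0 < p.+1%:R^-1 :> R by rewrite invr_gt0.
  have [v Dv qv] := dense_fball (q i) dDD (divr_gt0 p0 (ltr0n _ 2)).
  (* The first entry keeps [u] in [O]; the second, added to the distance from [q i] to [v], stays
     below 1/(p+1). *)
  pose eta := Num.min (e / 2) (p.+1%:R^-1 / 4).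
  have eta0 : 0 < eta by rewrite lt_min !divr_gt0.
  have [N [tau [N0 tau0 H]]] :=
    schedule_approx gam_gt0 opT TS D_gt0 hCS1 hCS2 Dv0 Dv eta0.
  have ga' : 4 * g * r%:R <= r%:R ^+ size w by rewrite wa.
  have [k [n [A [e1 [Nn sA cA]]]]] := exists_schedule L_nested r2
    (powR_gt0 gam rho0) tau0 (powR_gt0 gam D_gt0) N0 L_small N w0 ga'.
  have [u uv0 uA] := H A (L w) n e1 Nn (fun x => @proj2 _ _) sA.
  have [eta1 eta2] : eta <= e / 2 /\ eta <= p.+1%:R^-1 / 4.
    by rewrite !ge_min !lexx orbT.
  exists u; split.
    by apply: eO; rewrite /= fdist_sym fdistE; lra.
  move=> l /(_ k I) /cA[m _ Aml]; have [/(_ m l Aml)[nm _ _] _ _] := sA.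
  exists m; first by apply: leq_trans nm; exact: leq_trans Nn.
  have := fdist_triangle v (q i) (T m l u); have := uA m l Aml.
  rewrite -fdistE (fdist_sym (T m l u) v).
  by move: p0 qv eta2; move: (p.+1%:R^-1) => z; lra.
(* Codes of triples (i, p, w) enumerate the sets [U i p w]; invalid codes and words of another
   length give the whole space. *)
pose F n := if unpickle n is Some (i, p, w) then
  if size w == a then U i p w else setT else setT.
have F_open n : open (F n).
  rewrite /F; case: unpickle => [[[i p] w]|]; last exact: openT.
  by case: eqP => [wa|_]; [apply: U_open; rewrite wa|exact: openT].
have F_dense n : dense (F n).
  have dT : dense [set: X] by move=> O [x Ox] _; exists x.
  by rewrite /F; case: unpickle => [[[i p] w]|//]; case: eqP => // /U_dense.
have FE : common_universal Lam T = \bigcap_n F n.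
  apply/seteqP; split=> u Hu.
    move=> n _; rewrite /F; case: unpickle => [[[i p] w]|//].
    case: eqP => // wa l Cl; have Ll : Lam l by apply: C_sub Cl; rewrite wa.
    have p0 : 0 < p.+1%:R^-1 :> R by rewrite invr_gt0.
    by have [_ [m m0 <-] qm] := dense_fball (q i) (Hu l Ll) p0; exists m.
  move=> l Ll O [x Ox] oO; have [w wa Cwl] := C_cov l Ll.
  have [e e0 eO] := open_fball oO Ox.
  pose p := Num.truncn (2 / e).
  have p0 : 0 < p.+1%:R^-1 :> R by rewrite invr_gt0.
  have pe : p.+1%:R^-1 < e / 2.
    by rewrite -[e / 2]invrK invf_div ltf_pV2 ?posrE ?divr_gt0// truncnS_gt.
  have [_ [i _ <-] xq] := dense_fball x dq p0.
  have := Hu (pickle (i, p, w)) I; rewrite /F pickleK wa eqxx.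
  move=> /(_ l Cwl)[m m0 qm]; exists (T m l u); split; last by exists m.
  apply: eO => /=; have := fdist_triangle (q i) x (T m l u).
  by move: p0 pe xq qm; move: (p.+1%:R^-1) => z; lra.
rewrite FE; split; first exact: fspace_Baire.
by exists F.
Qed.
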